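(* Let $s$ be a state with deviations $w_1,w_2,w_3$. Then the lattice $\mathbb Zw_2+\mathbb Zw_3\subset\mathbb C$ contains a nonzero vector $w$ with $$|w|^2\le\frac{2}{\sqrt3}\cdot\frac{\delta x_1}{2|\xi|^2}=\frac{\delta x_1}{\sqrt3\,|\xi|^2}.$$ Moreover, since $T=m\delta/|\xi|$, this vector satisfies $$\frac{|w|^2}{T}\le\frac{x_1}{\sqrt3\,m\,|\xi|}\le\frac{1}{\sqrt3\,m}.$$
   Context: $K$ is a cubic number field of signature $(1,1)$, with real embedding $\sigma_r$ and complex embedding $\sigma_c$; $L\subset\mathcal O_K$ is an order. A state is an ordered triple $s=(u_1,u_2,u_3)$ of elements of $L$ forming a $\mathbb Q$-basis of $K$ with $x_i=\sigma_r(u_i)>0$, sorted so that $x_1\ge x_2\ge x_3>0$. Put $\xi=(x_1,x_2,x_3)$, $\nu=(\sigma_c(u_1),\sigma_c(u_2),\sigma_c(u_3))=a+ib$ with $a,b\in\mathbb R^3$, and $\delta=2|\det(\xi,a,b)|=|\mathrm{disc}(u_1,u_2,u_3)|^{1/2}$. Let $\bar\zeta=\langle\xi,\nu\rangle/|\xi|^2\in\mathbb C$ (bilinear dot product; the bar is part of the symbol) and $w_i=\sigma_c(u_i)-\bar\zeta x_i$ (the deviations). Set $T=\sum_i|w_i|^2$, let $A_\perp=|a_\perp\times b_\perp|$ where $a_\perp=\operatorname{Re}(w)$, $b_\perp=\operatorname{Im}(w)\in\mathbb R^3$ are the real and imaginary parts of $(w_1,w_2,w_3)$, and $m=T/(2A_\perp)$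 (the conformal module). *)

(* Defs.v *)
From HB Require Import structures.
From mathcomp Require Import all_boot all_order all_algebra all_field.
From mathcomp Require Import complex reals.

Set Implicit Arguments.
Unset Strict Implicit.
Unset Printing Implicit Defensive.
Import Order.TTheory GRing.Theory Num.Theory.
Local Open Scope ring_scope.
Local Open Scope complex_scope.

Definition nonreal_embedding (R : realType) (K : fieldExtType rat)
    (f : {rmorphism K -> R[i]}) : Prop :=
  exists z : K, complex.Im (f z) != 0.

Definition conj_eq (R : realType) (K : Type) (f g : K -> R[i]) : Prop :=
  f =1 g \/ f =1 (fun z => (g z)^*).

(* Exactly r real embeddings, and exactly s pairs of conjugate non-real
   complex embeddings. *)
Definition has_signature (R : realType) (K : fieldExtType rat) (r s : nat) :
    Prop :=
  (exists rho : 'I_r -> {rmorphism K -> R},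
     (forall i j, rho i =1 rho j -> i = j) /\
     (forall f : {rmorphism K -> R}, exists i, f =1 rho i)) /\
  (exists tau : 'I_s -> {rmorphism K -> R[i]},
     [/\ forall i, nonreal_embedding (tau i),
         forall i j, conj_eq (tau i) (tau j) -> i = j
       & forall f : {rmorphism K -> R[i]}, nonreal_embedding f ->
           exists i, conj_eq f (tau i)]).

Definition is_order (K : fieldExtType rat) (L : {pred K}) : Prop :=
  [/\ subring_closed L,
      forall z, z \in L -> integralOver (intr : int -> K) z
    & exists e : (\dim {:K}).-tuple K, basis_of {:K} e /\
        forall z, z \in L <->
          exists c : 'I_(\dim {:K}) -> int, z = \sum_i tnth e i *~ c i].

(* Indices 0, 1, 2 : 'I_3 stand for the subscripts 1, 2, 3. *)
Definition is_state (R : realType) (K : fieldExtType rat)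
    (sr : {rmorphism K -> R}) (L : {pred K}) (u : 3.-tuple K) : Prop :=
  [/\ forall i, tnth u i \in L,
      basis_of {:K} u
    & [/\ sr (tnth u 1) <= sr (tnth u 0), sr (tnth u 2) <= sr (tnth u 1)
        & 0 < sr (tnth u 2)]].

(* The library norm on row vectors is the sup norm. *)
Definition enorm (R : realType) (n : nat) (v : 'rV[R]_n) : R :=
  Num.sqrt (\sum_i v 0 i ^+ 2).

(* Addition of indices is modulo 3. *)
Definition crossmx (R : realType) (v w : 'rV[R]_3) : 'rV[R]_3 :=
  \row_k (v 0 (k + 1) * w 0 (k + 2) - v 0 (k + 2) * w 0 (k + 1)).

Definition xi (R : realType) (K : fieldExtType rat)
    (sr : {rmorphism K -> R}) (u : 3.-tuple K) : 'rV[R]_3 :=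
  \row_i sr (tnth u i).

Definition nu (R : realType) (K : fieldExtType rat)
    (sc : {rmorphism K -> R[i]}) (u : 3.-tuple K) : 'rV[R[i]]_3 :=
  \row_i sc (tnth u i).

Definition re_mx (R : realType) (v : 'rV[R[i]]_3) : 'rV[R]_3 :=
  \row_i complex.Re (v 0 i).

Definition im_mx (R : realType) (v : 'rV[R[i]]_3) : 'rV[R]_3 :=
  \row_i complex.Im (v 0 i).

Definition det3 (R : realType) (a b c : 'rV[R]_3) : R :=
  \det (col_mx a (col_mx b c) : 'M[R]_3).

Definition delta (R : realType) (K : fieldExtType rat)
    (sr : {rmorphism K -> R}) (sc : {rmorphism K -> R[i]})
    (u : 3.-tuple K) : R :=
  2 * `|det3 (xi sr u) (re_mx (nu sc u)) (im_mx (nu sc u))|.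

(* The product of xi and nu is bilinear: there is no conjugation. *)
Definition zetabar (R : realType) (K : fieldExtType rat)
    (sr : {rmorphism K -> R}) (sc : {rmorphism K -> R[i]})
    (u : 3.-tuple K) : R[i] :=
  (\sum_i (xi sr u 0 i)%:C * nu sc u 0 i) / (enorm (xi sr u) ^+ 2)%:C.

Definition deviations (R : realType) (K : fieldExtType rat)
    (sr : {rmorphism K -> R}) (sc : {rmorphism K -> R[i]})
    (u : 3.-tuple K) : 'rV[R[i]]_3 :=
  \row_i (sc (tnth u i) - zetabar sr sc u * (sr (tnth u i))%:C).

(* Normc.normc is the modulus as an element of R; `|z| has type R[i]. *)
Definition total_dev (R : realType) (K : fieldExtType rat)
    (sr : {rmorphism K -> R}) (sc : {rmorphism K -> R[i]})
    (u : 3.-tuple K) : R :=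
  \sum_i Normc.normc (deviations sr sc u 0 i) ^+ 2.

Definition area_perp (R : realType) (K : fieldExtType rat)
    (sr : {rmorphism K -> R}) (sc : {rmorphism K -> R[i]})
    (u : 3.-tuple K) : R :=
  enorm (crossmx (re_mx (deviations sr sc u)) (im_mx (deviations sr sc u))).

Definition conf_module (R : realType) (K : fieldExtType rat)
    (sr : {rmorphism K -> R}) (sc : {rmorphism K -> R[i]})
    (u : 3.-tuple K) : R :=
  total_dev sr sc u / (2 * area_perp sr sc u).

Definition real_independent (R : realType) (z1 z2 : R[i]) : Prop :=
  forall s t : R, s%:C * z1 + t%:C * z2 = 0 -> s = 0 /\ t = 0.

Definition int_span (R : realType) (z1 z2 w : R[i]) : Prop :=
  exists p q : int, w = z1 *~ p + z2 *~ q.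

(* Main.v *)
Require Import Defs.
From HB Require Import structures.
From mathcomp Require Import all_boot all_order all_algebra all_field.
From mathcomp Require Import complex reals.
From mathcomp Require Import ring lra zify.

Set Implicit Arguments.
Unset Strict Implicit.
Unset Printing Implicit Defensive.
Import Order.TTheory GRing.Theory Num.Theory.
Local Open Scope ring_scope.
Local Open Scope complex_scope.

(** The bound on shortest lattice vectors is Hermite's bound in dimension two,
    applied to the lattice spanned by the last two deviations; the work is to
    see that this lattice has rank two and to compute its covolume.

    Rank.  The determinant of [xi], [Re nu], [Im nu] is nonzero: otherwise the
    three functions [sr], [Re sc], [Im sc] satisfy a real linear relation on a
    rational basis, hence on all of the field, and evaluating it at 1, z, z^2
    for one z with [sc z] not real kills its coefficients
    ([embeddings_independent], [det_embeddings_neq0]).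

    Covolume.  The real and imaginary parts of the deviations are the
    components of [Re nu] and [Im nu] orthogonal to [xi], so their cross product
    is a multiple of [xi], with factor the determinant divided by |xi|^2
    ([cross_perp]).  Its length is the perpendicular area, which is therefore
    delta / (2 |xi|): this is the formula T = m delta / |xi|.  Its first
    coordinate is the oriented area of the parallelogram on w_2, w_3, so the
    covolume is delta x_1 / (2 |xi|^2).

    Hermite's bound.  For a positive definite binary form, among all pairs of
    coprime integers one minimizes the form, because sublevel sets are bounded.
    Completing it to a unimodular basis whose second vector has been reduced
    modulo the first, and comparing the two values through the determinant of
    the form, gives the constant 2 / sqrt 3 ([hermite_binform]). *)

(** * Hermite's bound for binary quadratic forms *)

(** Only the pairs whose value is at most that of [z0] compete, and these lie in
    a box, so the minimum is taken over a finite type. *)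
Lemma int_pair_minimizer (R : realDomainType) (P : pred (int * int))
    (F : int * int -> R) (N : nat) (z0 : int * int) :
  P z0 ->
  (forall z, P z -> F z <= F z0 -> `|z.1| <= N%:Z /\ `|z.2| <= N%:Z) ->
  exists2 z, P z & forall z', P z' -> F z <= F z'.
Proof.
move=> Pz0 box.
(* [(i, j)] in the square of side 2N + 1 encodes the pair [(i - N, j - N)]. *)
pose I : finType := ('I_(N.*2.+1) * 'I_(N.*2.+1))%type.
pose dec (i : I) : int * int := (i.1%:Z - N%:Z, i.2%:Z - N%:Z).
have decK z : P z -> F z <= F z0 -> exists i, dec i = z.
  move=> Pz Fz; have [b1 b2] := box z Pz Fz.
  case: z {Pz Fz} b1 b2 => p q /= b1 b2.
  have shift (k : int) : `|k| <= N%:Z ->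
      (absz (k + N%:Z)%R < N.*2.+1)%N /\ (absz (k + N%:Z))%:Z - N%:Z = k.
    by clear; move=> hk; split; lia.
  have [[p1 p2] [q1 q2]] := (shift p b1, shift q b2).
  exists (inord (absz (p + N%:Z)), inord (absz (q + N%:Z))).
  by rewrite /dec /= !inordK // p2 q2.
have [i0 e0] := decK z0 Pz0 (lexx _).
have Pi0 : P (dec i0) by rewrite e0.
case: (@arg_minP _ _ _ i0 (P \o dec) (F \o dec) Pi0) => i /= Pi mini.
exists (dec i) => // z' Pz'.
have [le'|lt'] := leP (F z') (F z0).
  by have [j ej] := decK z' Pz' le'; rewrite -ej; apply: mini; rewrite /= ej.
by rewrite (le_trans _ (ltW lt')) // -e0; apply: mini.
Qed.

Definition binform (R : pzRingType) (A B C p q : R) : R :=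
  A * p ^+ 2 + 2 * B * p * q + C * q ^+ 2.

(** With D = AC - B^2 and Q the value of the form at (p, q), the identities
    A Q = (A p + B q)^2 + D q^2 and C Q = (B p + C q)^2 + D p^2 bound p and q. *)
Lemma binform_sublevel_box (R : archiRealFieldType) (A B C M : R) :
  0 < A -> B ^+ 2 < A * C -> 0 <= M ->
  exists N : nat, forall p q : int,
    binform A B C p%:~R q%:~R <= M -> `|p| <= N%:Z /\ `|q| <= N%:Z.
Proof.
move=> A0 hD M0.
have C0 : 0 < C by have := sqr_ge0 B; nra.
pose D := A * C - B ^+ 2; have D0 : 0 < D by rewrite /D subr_gt0.
pose X := (A + C) * M / D.
have X0 : 0 <= X by apply: divr_ge0; [apply: mulr_ge0 => //; lra | exact: ltW].
exists (Num.bound X) => p q Q.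
have XN := archi_boundP X0; set N := Num.bound X in XN *.
have XD : (A + C) * M = X * D by rewrite /X divfK // gt_eqF.
have sq_bound (k : int) : (k%:~R : R) ^+ 2 <= X -> `|k| <= N%:Z.
  move=> h; have : ((k ^+ 2)%:~R : R) < N%:Z%:~R by rewrite rmorphXn /=; lra.
  by rewrite ltr_int => h'; nia.
have hp : D * p%:~R ^+ 2 <= C * M.
  have : C * binform A B C p%:~R q%:~R <= C * M by rewrite ler_pM2l.
  have := sqr_ge0 (B * p%:~R + C * q%:~R : R); rewrite /binform /D; lra.
have hq : D * q%:~R ^+ 2 <= A * M.
  have : A * binform A B C p%:~R q%:~R <= A * M by rewrite ler_pM2l.
  have := sqr_ge0 (A * p%:~R + B * q%:~R : R); rewrite /binform /D; lra.
have AM : 0 <= A * M by rewrite mulr_ge0 // ltW.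
have CM : 0 <= C * M by rewrite mulr_ge0 // ltW.
by split; apply: sq_bound; rewrite -(ler_pM2l D0); lra.
Qed.

(** Coprimality of (p, q) serves twice: it excludes (0, 0), and it is the
    condition for (p, q) to extend to a basis of the integer lattice.  The
    second basis vector (r1, s1) is coprime too, hence Q (p, q) <= Q (r1, s1),
    and the Gram determinant Q (p, q) Q (r1, s1) - inner^2 equals AC - B^2; since
    inner^2 <= Q (p, q)^2 / 4, this forces 3/4 Q (p, q)^2 <= AC - B^2. *)
Lemma hermite_binform (R : archiRealFieldType) (A B C : R) :
  0 < A -> B ^+ 2 < A * C ->
  exists p q : int, coprimez p q /\
    3 * binform A B C p%:~R q%:~R ^+ 2 <= 4 * (A * C - B ^+ 2).
Proof.
move=> A0 hD.
pose Q (z : int * int) := binform A B C z.1%:~R z.2%:~R.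
have Q10 : Q (1, 0) = A by rewrite /Q /binform /=; ring.
have [N box] := binform_sublevel_box A0 hD (ltW A0).
have [||[p q] cpq minQ] :=
  @int_pair_minimizer _ (fun z => coprimez z.1 z.2) Q N (1, 0).
- by [].
- by case=> p q _; rewrite Q10; apply: box.
exists p, q; split=> //; rewrite -/(Q (p, q)).
have /coprimezP[[s r'] /= bez] := cpq.
pose r := - r'.
(* the polarization of the form, paired with the minimizer [(p, q)] *)
pose inner (r s : int) : R := A * p%:~R * r%:~R
  + B * (p%:~R * s%:~R + q%:~R * r%:~R) + C * q%:~R * s%:~R.
have Qpos : 0 < Q (p, q).
  have [q0|q0] := eqVneq q 0.
    have p1 : p ^+ 2 = 1.
      move: cpq; rewrite /= q0 coprimezE /coprime gcdn0 => /eqP {minQ} p1.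
      suff [->|->] : p = 1 \/ p = -1 by [].
      move: p1; clear; case: p => n /=; lia.
    have -> : Q (p, q) = A * (p ^+ 2)%:~R by rewrite /Q /binform q0 /=; ring.
    by rewrite p1 mulr1.
  have q2 : 0 < (q%:~R : R) ^+ 2 by rewrite exprn_even_gt0 //= intr_eq0.
  rewrite -(pmulr_rgt0 _ A0) /Q /binform /=.
  have := sqr_ge0 (A * p%:~R + B * q%:~R : R).
  have : 0 < (A * C - B ^+ 2) * q%:~R ^+ 2 by rewrite mulr_gt0 // subr_gt0.
  lra.
(* [k] is an integer nearest to [- inner r s / Q (p, q)]: adding [k] times
   [(p, q)] brings the inner product within half of [Q (p, q)] of zero. *)
pose k := Num.floor (- inner r s / Q (p, q) + 1 / 2).
pose r1 := r + k * p; pose s1 := s + k * q.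
have det1 : p * s1 - q * r1 = 1 by rewrite /s1 /r1 /r -bez; ring.
have inner1 : inner r1 s1 = inner r s + k%:~R * Q (p, q).
  by rewrite /inner /r1 /s1 /Q /binform /=; ring.
have small : inner r1 s1 ^+ 2 <= Q (p, q) ^+ 2 / 4.
  have /andP[k1 k2] := floor_itv (- inner r s / Q (p, q) + 1 / 2).
  rewrite -/k in k1 k2; rewrite rmorphD /= in k2.
  pose y := inner r s / Q (p, q).
  have yE : inner r s = y * Q (p, q) by rewrite /y divfK // gt_eqF.
  have k1' : k%:~R <= - y + 1 / 2 by rewrite /y -mulNr.
  have k2' : - y + 1 / 2 < k%:~R + 1 by rewrite /y -mulNr.
  rewrite inner1 yE -mulrDl exprMn.
  suff : (y + k%:~R) ^+ 2 <= 1 / 4 by have := sqr_ge0 (Q (p, q)); nra.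
  nra.
have c1 : coprimez r1 s1.
  by apply/coprimezP; exists (- q, p) => /=; rewrite -det1; ring.
have min1 : Q (p, q) <= Q (r1, s1) := minQ (r1, s1) c1.
have gram : Q (p, q) * Q (r1, s1) - inner r1 s1 ^+ 2 = A * C - B ^+ 2.
  have -> : A * C - B ^+ 2 = (A * C - B ^+ 2) * (p * s1 - q * r1)%:~R ^+ 2.
    by rewrite det1 expr1n mulr1.
  by rewrite /Q /inner /binform /=; ring.
have : Q (p, q) ^+ 2 <= Q (p, q) * Q (r1, s1) by rewrite expr2 ler_pM2l.
lra.
Qed.

(** * Planar lattices *)

Lemma normc_sqr (R : rcfType) (z : R[i]) :
  Normc.normc z ^+ 2 = complex.Re z ^+ 2 + complex.Im z ^+ 2.
Proof. by case: z => p q; rewrite /= sqr_sqrtr // addr_ge0 ?sqr_ge0. Qed.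

Definition signed_area (R : pzRingType) (z1 z2 : R[i]) : R :=
  complex.Re z1 * complex.Im z2 - complex.Re z2 * complex.Im z1.

Lemma signed_area_independent (R : realType) (z1 z2 : R[i]) :
  signed_area z1 z2 != 0 -> real_independent z1 z2.
Proof.
case: z1 z2 => [p1 q1] [p2 q2]; rewrite /signed_area /= => a0 s t.
move/eqP; rewrite eq_complex /= => /andP[/eqP e1 /eqP e2].
split; apply: (mulIf a0); rewrite mul0r.
(* Cramer's rule: eliminate t, then s, from the real and imaginary parts. *)
- transitivity (q2 * (s * p1 - 0 * q1 + (t * p2 - 0 * q2))
    - p2 * (s * q1 + 0 * p1 + (t * q2 + 0 * p2))); first by ring.
  by rewrite e1 e2; ring.
- transitivity (p1 * (s * q1 + 0 * p1 + (t * q2 + 0 * p2))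
    - q1 * (s * p1 - 0 * q1 + (t * p2 - 0 * q2))); first by ring.
  by rewrite e1 e2; ring.
Qed.

(** The squared norm on the lattice is a binary form whose coefficients are the
    Gram matrix of z1, z2, and the Gram determinant is the squared area. *)
Lemma hermite_plane_lattice (R : realType) (z1 z2 : R[i]) :
  signed_area z1 z2 != 0 ->
  exists w, [/\ int_span z1 z2 w, w != 0
    & Normc.normc w ^+ 2 <= 2 / Num.sqrt 3 * `|signed_area z1 z2|].
Proof.
move=> a0; have ind := signed_area_independent a0.
pose A := Normc.normc z1 ^+ 2; pose C := Normc.normc z2 ^+ 2.
pose B := complex.Re z1 * complex.Re z2 + complex.Im z1 * complex.Im z2.
have gram : A * C - B ^+ 2 = signed_area z1 z2 ^+ 2.
  by rewrite /A /B /C !normc_sqr /signed_area; ring.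
have g0 : 0 < A * C - B ^+ 2 by rewrite gram exprn_even_gt0.
have A0 : 0 < A.
  rewrite lt_def sqr_ge0 andbT; apply: contraTneq g0 => ->.
  by rewrite mul0r sub0r oppr_gt0 -leNgt sqr_ge0.
have [|p [q [cpq pq]]] := @hermite_binform R A B C A0.
  by rewrite -subr_gt0.
pose w := z1 *~ p + z2 *~ q.
have wE : w = (p%:~R)%:C * z1 + (q%:~R)%:C * z2.
  by rewrite /w !rmorph_int !mulrzl.
have normw : Normc.normc w ^+ 2 = binform A B C p%:~R q%:~R.
  rewrite wE /binform /A /B /C !normc_sqr.
  by case: (z1) (z2) => [p1 q1] [p2 q2] /=; ring.
exists w; split; first by exists p, q.
  apply/eqP => w0; rewrite w0 in wE.
  have [/eqP p0 /eqP q0] := ind _ _ (esym wE).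
  move: p0 q0 cpq; rewrite !intr_eq0 => /eqP-> /eqP->.
  by rewrite coprimezE.
have s3 : 0 < Num.sqrt 3 :> R by rewrite sqrtr_gt0.
have N0 : 0 <= Normc.normc w ^+ 2 by exact: sqr_ge0.
rewrite normw in N0 *.
rewrite mulrAC ler_pdivlMr // -ler_sqr ?nnegrE ?mulr_ge0 ?(ltW s3) //.
by rewrite !exprMn real_normK ?num_real // sqr_sqrtr // -gram; lra.
Qed.

(** * Vectors in three-space *)

Lemma ord3_ind (P : 'I_3 -> Prop) : P 0 -> P 1 -> P 2 -> forall i, P i.
Proof.
move=> P0 P1 P2 [[|[|[|//]]] hk].
- by rewrite (_ : Ordinal hk = 0) //; apply: val_inj.
- by rewrite (_ : Ordinal hk = 1) //; apply: val_inj.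
- by rewrite (_ : Ordinal hk = 2) //; apply: val_inj.
Qed.

Lemma sum3E (V : nmodType) (F : 'I_3 -> V) : \sum_i F i = F 0 + F 1 + F 2.
Proof.
rewrite !big_ord_recr big_ord0 /= add0r.
by congr (F _ + F _ + F _); apply: val_inj.
Qed.

(** The block matrix defining [det3] is indexed by 1 + (1 + 1); this presents
    the determinant through a matrix indexed by 3, with known rows. *)
Lemma det3_rows (R : realType) (a b c : 'rV[R]_3) :
  exists M : 'M[R]_3, det3 a b c = \det M /\
    [/\ forall j, M 0 j = a 0 j, forall j, M 1 j = b 0 j
      & forall j, M 2 j = c 0 j].
Proof.
exists (col_mx a (col_mx b c)); split=> //; split=> j.
- have -> : (0 : 'I_3) = lshift 2 (0 : 'I_1) by apply: val_inj.
  exact: col_mxEu.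
- have -> : (1 : 'I_3) = rshift 1 (lshift 1 (0 : 'I_1)) by apply: val_inj.
  by rewrite (col_mxEd a); exact: col_mxEu.
- have -> : (2 : 'I_3) = rshift 1 (rshift 1 (0 : 'I_1)) by apply: val_inj.
  by rewrite (col_mxEd a); exact: col_mxEd.
Qed.

Lemma det3E (R : realType) (a b c : 'rV[R]_3) :
  det3 a b c = a 0 0 * (b 0 1 * c 0 2 - b 0 2 * c 0 1)
             + a 0 1 * (b 0 2 * c 0 0 - b 0 0 * c 0 2)
             + a 0 2 * (b 0 0 * c 0 1 - b 0 1 * c 0 0).
Proof.
have [M [-> [M0 M1 M2]]] := det3_rows a b c.
rewrite (expand_det_row _ 0) sum3E /cofactor.
have d2 (N : 'M[R]_2) : \det N = N 0 0 * N 1 1 - N 0 1 * N 1 0.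
  rewrite (expand_det_row _ 0) big_ord_recl big_ord1 /cofactor !det_mx11.
  rewrite !mxE /=.
  have -> : lift ord0 ord0 = 1 :> 'I_2 by apply: val_inj.
  have -> : lift 1 0 = 0 :> 'I_2 by apply: val_inj.
  by rewrite expr0 expr1 mul1r mulN1r mulrN.
have [e00 e01 e10] : [/\ lift (0 : 'I_3) (0 : 'I_2) = 1,
    lift (0 : 'I_3) (1 : 'I_2) = 2 & lift (1 : 'I_3) (0 : 'I_2) = 0].
  by split; apply: val_inj.
have [e11 e20 e21] : [/\ lift (1 : 'I_3) (1 : 'I_2) = 2,
    lift (2 : 'I_3) (0 : 'I_2) = 0 & lift (2 : 'I_3) (1 : 'I_2) = 1].
  by split; apply: val_inj.
rewrite !d2 !mxE e00 e01 e10 e11 e20 e21 !M0 !M1 !M2.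
by rewrite expr0 expr1 expr2; ring.
Qed.

Lemma crossmxE (R : realType) (a b : 'rV[R]_3) :
  [/\ crossmx a b 0 0 = a 0 1 * b 0 2 - a 0 2 * b 0 1,
      crossmx a b 0 1 = a 0 2 * b 0 0 - a 0 0 * b 0 2
    & crossmx a b 0 2 = a 0 0 * b 0 1 - a 0 1 * b 0 0].
Proof.
by split; rewrite mxE; congr (a 0 _ * b 0 _ - a 0 _ * b 0 _); apply: val_inj.
Qed.

Definition perp (R : realType) (x v : 'rV[R]_3) : 'rV[R]_3 :=
  v - ((\sum_i x 0 i * v 0 i) / enorm x ^+ 2) *: x.

Lemma enorm_sqr (R : realType) (v : 'rV[R]_3) :
  enorm v ^+ 2 = v 0 0 ^+ 2 + v 0 1 ^+ 2 + v 0 2 ^+ 2.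
Proof.
by rewrite /enorm sqr_sqrtr ?sumr_ge0 ?sum3E // => i _; rewrite sqr_ge0.
Qed.

(** Both factors are orthogonal to x, so their cross product is parallel to x;
    the multiple is found by pairing with x, as the components of a and b along
    x do not change the triple product. *)
Lemma cross_perp (R : realType) (x a b : 'rV[R]_3) : 0 < enorm x ->
  crossmx (perp x a) (perp x b) = (det3 x a b / enorm x ^+ 2) *: x.
Proof.
move=> x0; have n0 : enorm x ^+ 2 != 0 by rewrite gt_eqF ?exprn_gt0.
have [c0 c1 c2] := crossmxE (perp x a) (perp x b).
move: n0; rewrite enorm_sqr => n0.
apply/rowP; apply: ord3_ind; rewrite [RHS]mxE ?c0 ?c1 ?c2 det3E;
  by rewrite !mxE !sum3E enorm_sqr; field.
Qed.

Lemma enormZ (R : realType) n (c : R) (v : 'rV[R]_n) :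
  enorm (c *: v) = `|c| * enorm v.
Proof.
rewrite /enorm -sqrtr_sqr -sqrtrM ?sqr_ge0 //; congr Num.sqrt.
by rewrite mulr_sumr; apply: eq_bigr => i _; rewrite mxE exprMn.
Qed.

(** * The embeddings of the field *)

(** Artin's independence of characters for the embeddings [sr], [sc] and its
    conjugate, in real form.  Write [x] for [sr z] and [p + i q] for [sc z]; the
    relations at 1, z, z^2 have determinant q ((x - p)^2 + q^2), which is
    nonzero as soon as q is, so that a single z suffices. *)
Lemma embeddings_independent (R : realType) (K : fieldExtType rat)
    (sr : {rmorphism K -> R}) (sc : {rmorphism K -> R[i]})
    (c0 c1 c2 : R) :
  nonreal_embedding sc ->
  (forall z, c0 * sr z + c1 * complex.Re (sc z) + c2 * complex.Im (sc z) = 0) ->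
  [/\ c0 = 0, c1 = 0 & c2 = 0].
Proof.
move=> [z hz] h.
have h0 := h 1; have h1 := h z; have h2 := h (z ^+ 2).
rewrite !rmorph1 /= in h0; rewrite !rmorphXn /= in h2.
move: h1 h2 hz; case: (sc z) => p q; move: (sr z) => x /= h1 h2 q0.
rewrite expr2 /= in h2.
have D0 : q * ((x - p) ^+ 2 + q ^+ 2) != 0.
  rewrite mulf_neq0 // gt_eqF // ltr_wpDl ?sqr_ge0 //.
  by rewrite exprn_even_gt0.
have c00 : c0 = 0.
  apply: (mulfI D0); rewrite mulr0.
  (* The multipliers 1, - 2p, p^2 + q^2 are the coefficients of the minimal
     polynomial of p + i q over the reals, so c1 and c2 drop out. *)
  transitivity
    (q * (c0 * x ^+ 2 + c1 * (p * p - q * q) + c2 * (p * q + q * p))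
     - 2 * p * q * (c0 * x + c1 * p + c2 * q)
     + q * (p ^+ 2 + q ^+ 2) * (c0 * 1 + c1 * 1 + c2 * 0)); first by ring.
  by rewrite h0 h1 h2; ring.
have c10 : c1 = 0 by move: h0; rewrite c00; lra.
split=> //; apply: (mulIf q0); move: h1; rewrite c00 c10; lra.
Qed.

(** A vector v in the left kernel of the matrix is a real relation between the
    three functions on the basis u; it holds on all of K because [sr], [Re sc]
    and [Im sc] are linear over the rationals. *)
Lemma det_embeddings_neq0 (R : realType) (K : fieldExtType rat)
    (sr : {rmorphism K -> R}) (sc : {rmorphism K -> R[i]})
    (u : 3.-tuple K) :
  nonreal_embedding sc -> basis_of {:K} u ->
  det3 (xi sr u) (re_mx (nu sc u)) (im_mx (nu sc u)) != 0.
Proof.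
move=> hsc hu.
have [M [-> [M0 M1 M2]]] :=
  det3_rows (xi sr u) (re_mx (nu sc u)) (im_mx (nu sc u)).
apply/negP => /det0P[v /negP v0 vM]; apply: v0; apply/eqP.
have rel z : v 0 0 * sr z + v 0 1 * complex.Re (sc z)
    + v 0 2 * complex.Im (sc z) = 0.
  have zu : z \in <<u>>%VS by rewrite (span_basis hu) memvf.
  rewrite (coord_span zu) !rmorph_sum !raddf_sum /= !mulr_sumr.
  rewrite -!big_split /= big1 // => i _.
  rewrite -[_ *: _]mulr_algl !rmorphM alg_num_field !fmorph_rat.
  rewrite -(fmorph_rat (real_complex R)).
  set r := ratr _; have := congr1 (fun w : 'rV_3 => w 0 i) vM.
  rewrite !mxE sum3E M0 M1 M2 !mxE (tnth_nth 0).
  case: (sc u`_i) => p q /= h.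
  transitivity (r * (v 0 0 * sr u`_i + v 0 1 * p + v 0 2 * q)); first by ring.
  by rewrite h mulr0.
have [v0 v1 v2] := embeddings_independent hsc rel.
by apply/rowP; apply: ord3_ind; rewrite mxE.
Qed.

(** The factor [zetabar] is the orthogonal projection coefficient of [nu] on
    [xi], real and imaginary parts together. *)
Lemma deviations_perp (R : realType) (K : fieldExtType rat)
    (sr : {rmorphism K -> R}) (sc : {rmorphism K -> R[i]}) (u : 3.-tuple K) :
  re_mx (deviations sr sc u) = perp (xi sr u) (re_mx (nu sc u)) /\
  im_mx (deviations sr sc u) = perp (xi sr u) (im_mx (nu sc u)).
Proof.
pose S := \sum_i (xi sr u 0 i)%:C * nu sc u 0 i.
have ReS : complex.Re S = \sum_i xi sr u 0 i * re_mx (nu sc u) 0 i.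
  rewrite raddf_sum; apply: eq_bigr => i _; rewrite !mxE /=.
  by case: (sc _) => p q /=; ring.
have ImS : complex.Im S = \sum_i xi sr u 0 i * im_mx (nu sc u) 0 i.
  rewrite raddf_sum; apply: eq_bigr => i _; rewrite !mxE /=.
  by case: (sc _) => p q /=; ring.
split; apply/rowP => i; rewrite /perp -?ReS -?ImS !mxE /zetabar -/S -fmorphV /=;
  by case: S {ReS ImS} => S1 S2; case: (sc _) => p q /=; ring.
Qed.

(** * The short deviation vector *)

Theorem corollary3p4 (R : realType) (K : fieldExtType rat) (L : {pred K})
    (sr : {rmorphism K -> R}) (sc : {rmorphism K -> R[i]})
    (u : 3.-tuple K)
    (hdim : \dim {:K} = 3%N)
    (hsig : has_signature R K 1 1)
    (hsc : nonreal_embedding sc)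
    (hL : is_order L)
    (hu : is_state sr L u) :
  let x1 := sr (tnth u 0) in
  let normxi := enorm (xi sr u) in
  let d := delta sr sc u in
  let w2 := deviations sr sc u 0 1 in
  let w3 := deviations sr sc u 0 2 in
  let T := total_dev sr sc u in
  let m := conf_module sr sc u in
  [/\ real_independent w2 w3,
      T = m * d / normxi
    & exists w : R[i],
        [/\ int_span w2 w3 w,
            w != 0,
            Normc.normc w ^+ 2 <= 2 / Num.sqrt 3 * (d * x1 / (2 * normxi ^+ 2)),
            2 / Num.sqrt 3 * (d * x1 / (2 * normxi ^+ 2))
              = d * x1 / (Num.sqrt 3 * normxi ^+ 2)
          & Normc.normc w ^+ 2 / T <= x1 / (Num.sqrt 3 * m * normxi)
              <= 1 / (Num.sqrt 3 * m)]].
Proof.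
move=> x1 n d w2 w3 T m.
case: hu => _ hbasis [hx21 hx32 hx3].
have x1_gt0 : 0 < x1 by rewrite (lt_le_trans hx3) // (le_trans hx32).
have nE : n ^+ 2 = x1 ^+ 2 + sr (tnth u 1) ^+ 2 + sr (tnth u 2) ^+ 2.
  by rewrite enorm_sqr !mxE.
have x1n : x1 <= n.
  rewrite -ler_sqr ?nnegrE ?sqrtr_ge0 ?(ltW x1_gt0) // nE.
  by rewrite -addrA lerDl addr_ge0 ?sqr_ge0.
have n_gt0 : 0 < n := lt_le_trans x1_gt0 x1n.
pose D := det3 (xi sr u) (re_mx (nu sc u)) (im_mx (nu sc u)).
have D0 : D != 0 := det_embeddings_neq0 sr hsc hbasis.
have absD : 0 < `|D| by rewrite normr_gt0.
have [reE imE] := deviations_perp sr sc u.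
have crossE : crossmx (re_mx (deviations sr sc u)) (im_mx (deviations sr sc u))
    = (D / n ^+ 2) *: xi sr u by rewrite reE imE cross_perp.
have areaE : area_perp sr sc u = `|D| / n.
  rewrite /area_perp crossE enormZ normrM normfV (ger0_norm (sqr_ge0 n)) -/n.
  by field; rewrite gt_eqF.
have signedE : signed_area w2 w3 = D / n ^+ 2 * x1.
  have [] := crossmxE (re_mx (deviations sr sc u)) (im_mx (deviations sr sc u)).
  by rewrite crossE /signed_area /w2 /w3 !mxE => <- _ _.
have signed0 : signed_area w2 w3 != 0.
  rewrite signedE mulf_neq0 ?(gt_eqF x1_gt0) // mulf_neq0 // gt_eqF //.
  by rewrite invr_gt0 exprn_gt0.
have ind := signed_area_independent signed0.
have dE : d = 2 * `|D| by [].
have d_gt0 : 0 < d by rewrite dE mulr_gt0.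
have T_gt0 : 0 < T.
  have w20 : Normc.normc w2 ^+ 2 != 0.
    rewrite expf_neq0 //; apply: contra signed0 => /eqP/Normc.eq0_normc ->.
    by rewrite /signed_area /= mul0r mulr0 subrr.
  rewrite /T /total_dev (bigD1 1) //= ltr_pwDl ?sumr_ge0 //.
    by rewrite lt_def w20 sqr_ge0.
  by move=> i _; exact: sqr_ge0.
have mE : m = T * n / d.
  rewrite /m /conf_module areaE dE -/T; field.
  by rewrite !gt_eqF.
have m_gt0 : 0 < m by rewrite mE divr_gt0 // mulr_gt0.
have TE : T = m * d / n by rewrite mE; field; rewrite !gt_eqF.
have s3 : 0 < Num.sqrt 3 :> R by rewrite sqrtr_gt0.
have boundE : 2 / Num.sqrt 3 * (d * x1 / (2 * n ^+ 2))
    = d * x1 / (Num.sqrt 3 * n ^+ 2) by field; rewrite !gt_eqF.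
split=> //; have [w [wspan w0 wle]] := hermite_plane_lattice signed0.
have wle' : Normc.normc w ^+ 2 <= d * x1 / (Num.sqrt 3 * n ^+ 2).
  apply: le_trans wle _; rewrite -boundE ler_pM2l ?divr_gt0 // signedE.
  rewrite normrM normrM normfV (ger0_norm (sqr_ge0 n)) (gtr0_norm x1_gt0) dE.
  by rewrite le_eqVlt; apply/orP; left; apply/eqP; field; rewrite gt_eqF.
exists w; split=> //; first by rewrite boundE.
apply/andP; split.
  rewrite ler_pdivrMr // (le_trans wle') // TE le_eqVlt; apply/orP; left.
  by apply/eqP; field; rewrite !gt_eqF.
have -> : x1 / (Num.sqrt 3 * m * n) = x1 / n * (1 / (Num.sqrt 3 * m)).
  by field; rewrite !gt_eqF.
apply: ler_piMl; last by rewrite ler_pdivrMr // mul1r.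
by apply: ltW; rewrite divr_gt0 // mulr_gt0.
Qed.
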